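(* There is a non-centered maximal $15$-element clique in the collinearity graph of $\mathcal{P}_4(15)$ which is the union of a maximal singular subspace $\mathcal{S}$ of $\mathcal{P}_4(15)$ with a plane deleted and a plane disjoint from this subspace; that is, a non-centered maximal $15$-element clique of the form $(\mathcal{S}\setminus\mathcal{F}')\cup\mathcal{F}$, where $\mathcal{S}$ is a maximal singular subspace, $\mathcal{F}'\subset\mathcal{S}$ is a plane, and $\mathcal{F}$ is a plane of $\mathcal{P}_4(15)$ disjoint from $\mathcal{S}$.
   Context: $\mathcal{P}_4(15)$ is the point-line geometry whose points are all $8$-element subsets of $[15]=\{1,\dots,15\}$ and whose lines are all triples $\{X,Y,X\triangle Y\}$ such that $X,Y$ are distinct and $X,Y,X\triangle Y$ are all $8$-element subsets. Two distinct points $X,Y$ are collinear (lie on a common line) if and only if $|X\cap Y|=4$. The collinearity graph has the points as vertices, two distinct points being adjacent if and only if they are collinear. A set of points is a subspace if, together with any two collinear points in it, it contains the line joining them; a subspace is singular if any two distinct points of it are collinear. A maximal singular subspace is one maximal with respect to inclusion. A plane is a singular subspace isomorphic (with the lines it contains) to the Fano plane $\mathrm{PG}(2,2)$. A clique is maximal if it is maximal with respect to inclusion. A point $O\in\mathcal{C}$ of a maximal clique $\mathcal{C}$ is a center point if for every $C\in\mathcal{C}\setminus\{O\}$ the line joining $C$ and $O$ is contained in $\mathcal{C}$, i.e. $O\triangle C\in\mathcal{C}$. A maximal clique is centered if it has at least one center point, and non-centered otherwise. *)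

(* Defs.v *)
From HB Require Import structures.
From mathcomp Require Import all_boot all_order all_algebra.

Set Implicit Arguments.
Unset Strict Implicit.
Unset Printing Implicit Defensive.

Definition symdiff (T : finType) (A B : {set T}) : {set T} :=
  (A :\: B) :|: (B :\: A).

(* The ground set {1, ..., 15} is represented by 'I_15, and points by bare
   subsets of it; membership in points is imposed where it is needed. *)
Definition points : {set {set 'I_15}} := [set X : {set 'I_15} | #|X| == 8].

Definition lines : {set {set {set 'I_15}}} :=
  [set [set X; Y; symdiff X Y] | X : {set 'I_15} in points,
      Y : {set 'I_15} in points & (X != Y) && (symdiff X Y \in points)].

Definition collinear (X Y : {set 'I_15}) : bool :=
  [exists L in lines, (X \in L) && (Y \in L)].

Definition subspace (S : {set {set 'I_15}}) : bool :=
  (S \subset points) &&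
  [forall X in S, forall Y in S, forall L in lines,
     [&& X != Y, X \in L & Y \in L] ==> (L \subset S)].

Definition singular_subspace (S : {set {set 'I_15}}) : bool :=
  subspace S && [forall X in S, forall Y in S, (X != Y) ==> collinear X Y].

Definition maximal_singular_subspace (S : {set {set 'I_15}}) : bool :=
  maxset singular_subspace S.

(* The points (lines) of PG(2,2) are the subspaces of dimension 1 (resp. 2) of
   the vector space F_2^3, with inclusion as incidence.  An isomorphism from F,
   with the lines contained in F, is a bijection f from F onto the points of
   PG(2,2) under which the lines contained in F are exactly the preimages of
   the lines of PG(2,2). *)
Definition isomorphic_to_Fano (F : {set {set 'I_15}}) : Prop :=
  exists f : {set 'I_15} -> {vspace 'rV['F_2]_3},
    [/\ {in F &, injective f},
        forall X, X \in F -> \dim (f X) = 1,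
        forall U : {vspace 'rV['F_2]_3}, \dim U = 1 ->
          exists2 X, X \in F & f X = U
      & forall L : {set {set 'I_15}}, L \subset F ->
          (L \in lines <->
           exists W : {vspace 'rV['F_2]_3},
             \dim W = 2 /\ L = [set X in F | (f X <= W)%VS])].

Definition plane (F : {set {set 'I_15}}) : Prop :=
  singular_subspace F /\ isomorphic_to_Fano F.

Definition adjacent (X Y : {set 'I_15}) : bool := (X != Y) && collinear X Y.

Definition clique (C : {set {set 'I_15}}) : bool :=
  (C \subset points) &&
  [forall X in C, forall Y in C, (X != Y) ==> adjacent X Y].

Definition maximal_clique (C : {set {set 'I_15}}) : bool := maxset clique C.

(* For a clique C there is exactly one line through O and any other X in C, so
   the quantification over L below ranges over the line joining O and X. *)
Definition center_point (C : {set {set 'I_15}}) (O : {set 'I_15}) : bool :=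
  (O \in C) &&
  [forall X in C :\ O, forall L in lines,
     ((O \in L) && (X \in L)) ==> (L \subset C)].

Definition centered (C : {set {set 'I_15}}) : bool :=
  [exists O, center_point C O].

(* Main.v *)
Require Import Defs.
From HB Require Import structures.
From mathcomp Require Import all_boot all_order all_algebra.
From mathcomp Require Import zify.

Set Implicit Arguments.
Unset Strict Implicit.
Unset Printing Implicit Defensive.

Import GRing.Theory.

(** Label the ground set by the nonzero vectors [(z, t)] of F_2^3 x F_2.  The
    words [{v | <a, v> <> 0}], for [a] nonzero, are the 15 complements of linear
    hyperplanes ([solid]); they have 8 elements each and add up like vectors, so
    they form a PG(3, 2), the singular subspace S.  The words with [a = (b, 0)]
    form a plane F' of S ([solid_plane]).  Such a word omits the vector
    [p = (0, 1)] and is a union of pairs [{(z, 0), (z, 1)}], whereas a word with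
    [a = (b, 1)] contains [p] and meets each pair in one element.  A word of the
    second kind therefore meets every 8-set of the first shape in exactly four
    elements, linear or not.

    This freedom allows F' to be switched.  Let [c] be the map [z |-> z^3] of
    F_8 = F_2^3, which is bijective and fixes 0, and let F consist of the sets
    [{(z, t) | <b, c z> <> 0}] for [b] nonzero.  Relabelling the ground set along
    the bijection [(z, t) |-> (c z, t)] turns F into F', so F is a plane too
    ([plane_solid_plane] at two labellings), and the union of S \ F' and F is a clique of 15
    points ([clique_switched]).  F is disjoint from S because no nonzero linear
    form composed with [c] is linear ([cube_component_nonlinear]).

    Maximality of both S and the switched clique comes from one double count:
    each covers every element of the ground set 8 times, and then an 8-set
    meeting all 15 members in 4 elements would give 8 * 8 = 15 * 4
    ([regular_family_saturated]).

    No point [O] is a center ([not_centered_switched]).  For [O] in S \ F', the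
    third point of the line joining it to another point of S \ F' lies in F',
    which was removed.  For [O] in F and [B] in S \ F', the third point lies
    neither in S nor in F, as then [O] would be in S or [B] in F. *)

(** * Symmetric differences and lines *)

Section SymmetricDifference.
Variable T : finType.
Implicit Types A B D : {set T}.

Lemma in_symdiff A B i : (i \in symdiff A B) = (i \in A) (+) (i \in B).
Proof. by rewrite !inE; case: (i \in A); case: (i \in B). Qed.

Lemma symdiffC A B : symdiff A B = symdiff B A.
Proof. by apply/setP=> i; rewrite !in_symdiff addbC. Qed.

Lemma symdiffKl A B : symdiff A (symdiff A B) = B.
Proof. by apply/setP=> i; rewrite !in_symdiff addKb. Qed.

Lemma card_symdiff A B :
  (#|symdiff A B| + (#|A :&: B|).*2 = #|A| + #|B|)%N.
Proof.
have -> : #|symdiff A B| = (#|A :\: B| + #|B :\: A|)%N.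
  rewrite /symdiff cardsU; suff -> : (A :\: B) :&: (B :\: A) = set0.
    by rewrite cards0 subn0.
  by apply/setP=> i; rewrite !inE; case: (i \in A); case: (i \in B).
by rewrite -(cardsID B A) -(cardsID A B) (setIC B A); lia.
Qed.

End SymmetricDifference.

Lemma mem_points (X : {set 'I_15}) : (X \in points) = (#|X| == 8).
Proof. by rewrite inE. Qed.

Lemma line_in_lines (X Y : {set 'I_15}) :
  X \in points -> Y \in points -> symdiff X Y \in points ->
  [set X; Y; symdiff X Y] \in lines.
Proof.
move=> pX pY pXY; apply/imset2P; exists X Y => //.
rewrite inE pY pXY andbT; apply: contraTneq pXY => ->.
by rewrite mem_points /symdiff setDv setU0 cards0.
Qed.

Lemma line_eq (L : {set {set 'I_15}}) (X Y : {set 'I_15}) :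
  L \in lines -> X \in L -> Y \in L -> X != Y ->
  L = [set X; Y; symdiff X Y] /\ symdiff X Y \in points.
Proof.
case/imset2P=> A B pA; rewrite inE => /and3P[pB _ pAB] ->.
have dA : symdiff A (symdiff A B) = B := symdiffKl A B.
have dB : symdiff B (symdiff A B) = A by rewrite (symdiffC A) symdiffKl.
have dA' : symdiff (symdiff A B) A = B by rewrite symdiffC.
have dB' : symdiff (symdiff A B) B = A by rewrite symdiffC.
rewrite !in_setU !in_set1 => /orP[/orP[]|]/eqP-> /orP[/orP[]|]/eqP->; rewrite ?eqxx //= => _;
  rewrite ?dA ?dB ?dA' ?dB' ?(symdiffC B A); split=> //;
  apply/setP=> Z; rewrite !inE;
  by case: (Z == A); case: (Z == B); case: (Z == symdiff A B).
Qed.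

Lemma collinear_symdiff (X Y : {set 'I_15}) :
  X \in points -> Y \in points -> X != Y ->
  collinear X Y = (symdiff X Y \in points).
Proof.
move=> pX pY nXY; apply/existsP/idP=> [[L /and3P[lL XL YL]]|pXY].
  by case: (line_eq lL XL YL nXY).
exists [set X; Y; symdiff X Y].
by rewrite line_in_lines // !inE !eqxx orbT.
Qed.

Lemma collinear_card_setI (X Y : {set 'I_15}) :
  X \in points -> Y \in points -> X != Y -> collinear X Y -> #|X :&: Y| = 4.
Proof.
move=> pX pY nXY; rewrite collinear_symdiff //.
move: pX pY; rewrite !mem_points => /eqP pX /eqP pY /eqP pXY.
by have := card_symdiff X Y; lia.
Qed.

(** * Regular families and maximality *)

Definition degree (D : {set {set 'I_15}}) (i : 'I_15) : nat :=
  \sum_(B in D) (i \in B).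

(** If [X] were outside [D] it would meet every member in 4 elements; the
    incidences between elements of [X] and members of [D] would then number
    8 * 8 on one side and 15 * 4 on the other. *)
Lemma regular_family_saturated (D : {set {set 'I_15}}) (X : {set 'I_15}) :
  D \subset points -> #|D| = 15 -> (forall i, degree D i = 8) ->
  X \in points -> (forall B, B \in D -> X != B -> collinear X B) -> X \in D.
Proof.
move=> /subsetP pD cD dD pX col; apply: contraT => nX.
have : (\sum_(i in X) degree D i = \sum_(B in D) #|X :&: B|)%N.
  rewrite exchange_big; apply: eq_bigr => B _.
  rewrite -sum1_card -big_mkcondr; apply: eq_bigl => i; by rewrite inE.
rewrite (eq_bigr (fun=> 8%N)) // sum_nat_const.
rewrite (eq_bigr (fun=> 4%N)) => [|B BD]; last first.
  have nXB : X != B by apply: contraNneq nX => ->.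
  exact: collinear_card_setI (pD _ BD) nXB (col _ BD nXB).
by rewrite sum_nat_const cD; move: pX; rewrite mem_points => /eqP ->.
Qed.

Lemma maximal_clique_regular (C : {set {set 'I_15}}) :
  clique C -> #|C| = 15 -> (forall i, degree C i = 8) -> maximal_clique C.
Proof.
move=> qC cC dC; apply/maxsetP; split=> // D /andP[pD /forall_inP aD] CD.
apply/eqP; rewrite eqEsubset CD andbT; apply/subsetP=> X XD.
have [pC _] := andP qC.
apply: regular_family_saturated (subsetP pD _ XD) _ => // B BC nXB.
by have /forall_inP/(_ B (subsetP CD _ BC))/implyP/(_ nXB)/andP[] := aD X XD.
Qed.

Lemma maximal_singular_regular (S : {set {set 'I_15}}) :
  singular_subspace S -> #|S| = 15 -> (forall i, degree S i = 8) ->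
  maximal_singular_subspace S.
Proof.
move=> sS cS dS; apply/maxsetP; split=> // D /andP[/andP[pD _] /forall_inP aD].
move=> SD; apply/eqP; rewrite eqEsubset SD andbT; apply/subsetP=> X XD.
have [/andP[pS _] _] := andP sS.
apply: regular_family_saturated (subsetP pD _ XD) _ => // B BS nXB.
by have /forall_inP/(_ B (subsetP SD _ BS))/implyP/(_ nXB) := aD X XD.
Qed.

Local Open Scope ring_scope.

(** * Additive families of points *)

Lemma F2_cases (k : 'F_2) : k = 0 \/ k = 1.
Proof.
by case: k => [[|[|//]] lt]; [left | right]; apply/val_inj.
Qed.

Lemma F2_addb (k l : 'F_2) : (k + l != 0) = (k != 0) (+) (l != 0).
Proof. by case: (F2_cases k) (F2_cases l) => -> [] ->. Qed.

Lemma F2_neq0_inj (k l : 'F_2) : (k != 0) = (l != 0) -> k = l.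
Proof. by case: (F2_cases k) (F2_cases l) => -> [] ->. Qed.

Lemma addvv n (v : 'rV['F_2]_n) : v + v = 0.
Proof.
rewrite -mulr2n -scaler_nat (_ : 2%:R = 0 :> 'F_2) ?scale0r //; exact/val_inj.
Qed.

Lemma addv_eq0 n (u v : 'rV['F_2]_n) : (u + v == 0) = (u == v).
Proof.
by rewrite -[RHS]subr_eq0; congr (_ == _); rewrite -[- v]add0r -(addvv v) addrK.
Qed.

(** A family of sets indexed additively by F_2^n carries its lines as the
    triples [{phi u, phi v, phi (u + v)}], so its geometry is that of the
    projective space of F_2^n as soon as its nonzero members are points. *)
Section AdditiveFamily.
Variables (n : nat) (phi : 'rV['F_2]_n -> {set 'I_15}).
Hypothesis phiD : forall u v, phi (u + v) = symdiff (phi u) (phi v).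
Hypothesis phi_point : forall u, u != 0 -> phi u \in points.

Lemma additive_inj : injective phi.
Proof.
move=> u v euv; apply/eqP; rewrite -addv_eq0; apply: contraT => /phi_point.
by rewrite phiD euv mem_points /symdiff setDv setU0 cards0.
Qed.

Lemma phi_adj u v : u != 0 -> v != 0 -> u != v ->
  symdiff (phi u) (phi v) \in points.
Proof. by move=> u0 v0 nuv; rewrite -phiD phi_point // addv_eq0. Qed.

Lemma singular_additive_image : singular_subspace (phi @: [set~ 0]).
Proof.
have pS : phi @: [set~ 0] \subset points.
  by apply/subsetP=> _ /imsetP[u + ->]; rewrite !inE => /phi_point; rewrite inE.
apply/andP; split; last first.
  apply/forall_inP=> X XS; apply/forall_inP=> Y YS; apply/implyP=> nXY.
  rewrite collinear_symdiff ?(subsetP pS _ XS) ?(subsetP pS _ YS) //.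
  move: XS YS nXY => /imsetP[u + ->] /imsetP[v + ->]; rewrite !in_setC !in_set1.
  by move=> u0 v0 nuv; apply: phi_adj => //; apply: contraNneq nuv => ->.
apply/andP; split=> //.
apply/forall_inP=> X XS; apply/forall_inP=> Y YS; apply/forall_inP=> L lL.
apply/implyP=> /and3P[nXY XL YL].
have [-> _] := line_eq lL XL YL nXY.
move: XS YS nXY => /imsetP[u u0 ->] /imsetP[v v0 ->] nuv.
rewrite -phiD !subUset !sub1set !imset_f //.
by rewrite !inE addv_eq0; apply: contraNneq nuv => ->.
Qed.

End AdditiveFamily.

(** * Planes from additive families *)

Lemma memv_line2 n (u v w : 'rV['F_2]_n) :
  (w \in <[u]> + <[v]>)%VS = (w \in [:: 0; u; v; u + v]).
Proof.
apply/idP/idP=> [/memv_addP[_ /vlineP[k ->] [_ /vlineP[l ->] ->]]|].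
  by case: (F2_cases k) (F2_cases l) => -> [] ->;
    rewrite ?scale0r ?scale1r ?add0r ?addr0 !inE eqxx ?orbT.
have uW : (u \in <[u]> + <[v]>)%VS by rewrite (subvP (addvSl _ _)) ?memv_line.
have vW : (v \in <[u]> + <[v]>)%VS by rewrite (subvP (addvSr _ _)) ?memv_line.
by rewrite !inE => /or4P[] /eqP ->; rewrite ?mem0v ?memvD.
Qed.

Lemma dimv_line2 n (u v : 'rV['F_2]_n) :
  u != 0 -> v != 0 -> u != v -> \dim (<[u]> + <[v]>) = 2%N.
Proof.
move=> u0 v0 nuv; rewrite dimv_disjoint_sum ?dim_vline ?u0 ?v0 //.
apply/eqP; rewrite -subv0; apply/subvP=> _ /memv_capP[/vlineP[k ->] /vlineP[l]].
case: (F2_cases k) (F2_cases l) => -> [] ->; rewrite ?scale0r ?scale1r ?mem0v //.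
  by move=> /eqP; rewrite (negPf u0).
by move=> /eqP; rewrite (negPf nuv).
Qed.

Lemma vline_F2_inj n (u v : 'rV['F_2]_n) : u != 0 -> <[u]>%VS = <[v]>%VS -> u = v.
Proof.
move=> u0 e; have := memv_line u; rewrite e => /vlineP[k].
by case: (F2_cases k) => ->; rewrite ?scale1r // scale0r => /eqP; rewrite (negPf u0).
Qed.

Lemma dim1_vline (K : fieldType) (V : vectType K) (U : {vspace V}) :
  \dim U = 1%N -> exists2 v, v != 0 & U = <[v]>%VS.
Proof.
move=> dU; have v0 : vpick U != 0 by rewrite vpick0 -dimv_eq0 dU.
exists (vpick U) => //; apply/esym/eqP.
by rewrite eqEdim -memvE memv_pick dim_vline v0 dU.
Qed.

Lemma dim2_span n (W : {vspace 'rV['F_2]_n}) : \dim W = 2%N ->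
  exists u v, [/\ u != 0, v != 0, u != v & W = (<[u]> + <[v]>)%VS].
Proof.
move=> dW; have u0 : vpick W != 0 by rewrite vpick0 -dimv_eq0 dW.
have [|v vW nv] := @subvPn _ _ W <[vpick W]> _.
  by apply/negP=> /dimvS; rewrite dW dim_vline u0.
have v0 : v != 0 by apply: contraNneq nv => ->; rewrite mem0v.
have nuv : vpick W != v by apply: contraNneq nv => <-; rewrite memv_line.
exists (vpick W), v; split=> //; apply/esym/eqP; rewrite eqEdim dimv_line2 // dW.
by rewrite subv_add -!memvE memv_pick vW.
Qed.

(** The isomorphism with PG(2, 2) sends [phi v] to the vector line [<[v]>]: over
    F_2 a nonzero vector is determined by the line it spans, and the nonzero
    vectors of the span of [u] and [v] are exactly [u], [v] and [u + v]. *)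
Lemma plane_additive_image (phi : 'rV['F_2]_3 -> {set 'I_15}) :
  (forall u v, phi (u + v) = symdiff (phi u) (phi v)) ->
  (forall u, u != 0 -> phi u \in points) ->
  plane (phi @: [set~ 0]).
Proof.
move=> phiD phiP; split; first exact: singular_additive_image.
have phiI := additive_inj phiD phiP.
(* A left inverse of [phi]; the default value 0 occurs only off its image. *)
pose psi X := odflt 0 [pick v | phi v == X].
have phiK : cancel phi psi.
  rewrite /psi => v; case: pickP => [w /eqP/phiI //|/(_ v)]; by rewrite eqxx.
have imE w : (phi w \in phi @: [set~ 0]) = (w != 0).
  by rewrite mem_imset // !inE.
have lineE u v : u != 0 -> v != 0 -> u != v ->
    [set phi u; phi v; symdiff (phi u) (phi v)] =
    [set X in phi @: [set~ 0] | (<[psi X]> <= <[u]> + <[v]>)%VS].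
  move=> u0 v0 nuv; apply/setP=> X; rewrite -phiD inE.
  apply/idP/andP=> [|[/imsetP[w + ->]]]; last first.
    rewrite !inE phiK -memvE memv_line2 !inE => /negPf -> /=.
    by move=> /or3P[] /eqP ->; rewrite eqxx ?orbT.
  by rewrite !inE -orbA => /or3P[] /eqP ->;
    rewrite imE phiK -memvE memv_line2 !inE eqxx ?orbT // addv_eq0.
exists (fun X => <[psi X]>%VS); split.
- move=> _ _ /imsetP[u + ->] /imsetP[v _ ->]; rewrite !inE !phiK => u0.
  by move/vline_F2_inj => ->.
- by move=> _ /imsetP[u + ->]; rewrite !inE phiK dim_vline => ->.
- move=> U /dim1_vline[v v0 ->]; exists (phi v); last by rewrite phiK.
  by rewrite imE.
move=> L LF; split=> [lL|[W [dW ->]]].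
  case/imset2P: (lL) => X Y pX; rewrite inE => /and3P[pY nXY _] eL.
  have [/imsetP[u + eX] /imsetP[v + eY]] :
      X \in phi @: [set~ 0] /\ Y \in phi @: [set~ 0].
    by split; apply: (subsetP LF); rewrite eL !inE eqxx ?orbT.
  rewrite !inE => u0 v0; have nuv : u != v.
    by apply: contraNneq nXY => e; rewrite eX eY e.
  exists (<[u]> + <[v]>)%VS; split; first exact: dimv_line2.
  by rewrite eL eX eY lineE.
have [u [v [u0 v0 nuv ->]]] := dim2_span dW.
by rewrite -lineE // line_in_lines ?phiP // phi_adj.
Qed.

(** * Hyperplane complements *)

Definition dot n (a v : 'rV['F_2]_n) : 'F_2 := (a *m v^T) 0 0.

Lemma dotDl n (a b v : 'rV['F_2]_n) : dot (a + b) v = dot a v + dot b v.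
Proof. by rewrite /dot mulmxDl mxE. Qed.

Lemma dotC n (a v : 'rV['F_2]_n) : dot a v = dot v a.
Proof. by rewrite /dot !mxE; apply: eq_bigr => k _; rewrite !mxE mulrC. Qed.

Lemma dotDr n (a u v : 'rV['F_2]_n) : dot a (u + v) = dot a u + dot a v.
Proof. by rewrite dotC dotDl !(dotC a). Qed.

Lemma dot0 n (a : 'rV['F_2]_n) : dot a 0 = 0.
Proof. by rewrite /dot trmx0 mulmx0 mxE. Qed.

Lemma dot_row m n (a u : 'rV['F_2]_m) (b v : 'rV['F_2]_n) :
  dot (row_mx a b) (row_mx u v) = dot a u + dot b v.
Proof. by rewrite /dot tr_row_mx mul_row_col mxE. Qed.

Lemma dot_delta n (a : 'rV['F_2]_n) k : dot a (delta_mx 0 k) = a 0 k.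
Proof. by rewrite /dot trmx_delta -colE mxE. Qed.

(** Adding a vector off the hyperplane exchanges it with its complement. *)
Lemma card_dot n (v : 'rV['F_2]_n.+1) :
  v != 0 -> #|[set a | dot a v != 0]| = (2 ^ n)%N.
Proof.
case/rV0Pn=> k vk; set H := [set _ | _].
pose t (a : 'rV['F_2]_n.+1) : 'rV['F_2]_n.+1 := a + delta_mx 0 k.
have tI : injective t by move=> a b /addIr.
have tH : [set t a | a in ~: H] = H.
  have step a : (t a \in H) = (a \notin H).
    by rewrite !inE dotDl [X in _ + X]dotC dot_delta F2_addb vk addbT negbK.
  have tt a : t (t a) = a by rewrite /t -addrA addvv addr0.
  apply/setP=> a; apply/imsetP/idP=> [[b + ->]|aH].
    by rewrite inE step.
  by exists (t a); rewrite ?tt // inE step aH.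
have := cardsC H; rewrite -(card_imset (~: H) tI) tH card_mx card_Fp //.
by rewrite mul1n expnS; lia.
Qed.

Definition word n (x : 'I_15 -> 'rV['F_2]_n) (a : 'rV['F_2]_n) : {set 'I_15} :=
  [set i | dot a (x i) != 0].

Lemma wordD n (x : 'I_15 -> 'rV['F_2]_n) a b :
  word x (a + b) = symdiff (word x a) (word x b).
Proof. by apply/setP=> i; rewrite in_symdiff !inE dotDl F2_addb. Qed.

Lemma word_point_neq0 n (x : 'I_15 -> 'rV['F_2]_n) a :
  word x a \in points -> a != 0.
Proof.
apply: contraTneq => ->; rewrite mem_points (_ : word x 0 = set0) ?cards0 //.
by apply/setP=> i; rewrite !inE dotC dot0 eqxx.
Qed.

(** Any two such labellings of the ground set differ by a permutation of the
    nonzero vectors, linear or not, and each of them gives a solid with a plane in it. *)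
Section Enumeration.
Variable x : 'I_15 -> 'rV['F_2]_(3 + 1).
Hypotheses (xI : injective x) (x0 : forall i, x i != 0).

Lemma codom_nonzero : x @: setT = [set~ 0].
Proof.
apply/eqP; rewrite eqEcard; apply/andP; split.
  by apply/subsetP=> _ /imsetP[i _ ->]; rewrite !inE.
by rewrite card_imset // cardsT card_ord cardsC1 card_mx card_Fp.
Qed.

(** Injectivity makes [x] a bijection onto the 15 nonzero vectors, so sets of
    labels can be counted in the whole space when 0 is excluded anyway. *)
Lemma card_preimage (P : pred 'rV['F_2]_(3 + 1)) :
  ~~ P 0 -> #|[set i | P (x i)]| = #|[set v | P v]|.
Proof.
move=> P0; rewrite -(card_imset _ xI); apply: eq_card => v; rewrite [RHS]inE.
apply/imsetP/idP=> [[i + ->]|Pv]; first by rewrite inE.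
have : v \in x @: setT by rewrite codom_nonzero !inE; apply: contraNneq P0 => <-.
by case/imsetP=> i _ e; exists i; rewrite // inE -e.
Qed.

Lemma word_point a : a != 0 -> word x a \in points.
Proof.
move=> a0; rewrite mem_points (@card_preimage (fun v => dot a v != 0)).
  rewrite -[8%N]/(2 ^ 3)%N -(card_dot a0); apply/eqP/eq_card=> v.
  by rewrite !inE dotC.
by rewrite dot0 eqxx.
Qed.

Definition solid := word x @: [set~ 0].
Definition solid_plane :=
  (fun b : 'rV['F_2]_3 => word x (row_mx b 0)) @: [set~ 0].

Lemma word_inj : injective (word x).
Proof. exact: additive_inj (wordD x) word_point. Qed.

Lemma row0_eq0 (b : 'rV['F_2]_3) : (row_mx b 0 == 0 :> 'rV_(3 + 1)) = (b == 0).
Proof. by rewrite row_mx_eq0 eqxx andbT. Qed.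

Lemma row0_inj : injective (fun b : 'rV['F_2]_3 => row_mx b 0 : 'rV_(3 + 1)).
Proof. by move=> b c /eq_row_mx[]. Qed.

Lemma plane_word_inj : injective (fun b : 'rV['F_2]_3 => word x (row_mx b 0)).
Proof. by move=> b c /word_inj/row0_inj. Qed.

Lemma solid_singular : singular_subspace solid.
Proof. exact: singular_additive_image (wordD x) word_point. Qed.

Lemma plane_solid_plane : plane solid_plane.
Proof.
apply: plane_additive_image => [u v|u u0].
  by rewrite -wordD add_row_mx addr0.
by rewrite word_point // row0_eq0.
Qed.

Lemma solid_plane_sub : solid_plane \subset solid.
Proof.
apply/subsetP=> _ /imsetP[b b0 ->]; apply: imset_f.
by move: b0; rewrite !inE row0_eq0.
Qed.

Lemma card_solid : #|solid| = 15%N.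
Proof. by rewrite card_imset ?cardsC1 ?card_mx ?card_Fp //; exact: word_inj. Qed.

Lemma card_solid_plane : #|solid_plane| = 7%N.
Proof. by rewrite card_imset ?cardsC1 ?card_mx ?card_Fp //; exact: plane_word_inj. Qed.

Lemma degree_imset n (phi : 'rV['F_2]_n -> {set 'I_15}) i :
  injective phi -> i \notin phi 0 ->
  degree (phi @: [set~ 0]) i = #|[set a | i \in phi a]|.
Proof.
move=> phiI i0; rewrite /degree big_imset /=; last by move=> ? ? _ _; exact: phiI.
rewrite -sum1_card -big_mkcondr; apply: eq_bigl => a; rewrite !inE.
by apply: andb_idl; apply: contraTneq => ->.
Qed.

Lemma degree_solid i : degree solid i = 8%N.
Proof.
rewrite degree_imset ?inE ?[dot 0 _]dotC ?dot0 ?eqxx //; last exact: word_inj.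
rewrite -[RHS]/(2 ^ 3)%N -(card_dot (x0 i)).
by apply: eq_card => a; rewrite !inE.
Qed.

(** The degree sees only whether the F_2^3 component vanishes; this is why a
    relabelling that preserves the vanishing of that component preserves the
    degrees. *)
Lemma degree_solid_plane i :
  degree solid_plane i = if lsubmx (x i) == 0 then 0%N else 4%N.
Proof.
have dE b : dot (row_mx b 0) (x i) = dot b (lsubmx (x i)).
  by rewrite -{1}(hsubmxK (x i)) dot_row [dot 0 _]dotC dot0 addr0.
rewrite degree_imset ?inE ?dE ?[dot 0 _]dotC ?dot0 ?eqxx //;
  last exact: plane_word_inj.
rewrite (eq_card (B := [set b | dot b (lsubmx (x i)) != 0])); last first.
  by move=> b; rewrite !inE dE.
case: eqP => [->|/eqP l0]; last by rewrite card_dot.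
by apply: eq_card0 => b; rewrite !inE dot0 eqxx.
Qed.

End Enumeration.

(** * Cubing in F_8 *)

Definition vec3 (p q r : 'F_2) : 'rV['F_2]_3 := \row_k [:: p; q; r]`_k.

Lemma dot_vec3 b p q r :
  dot b (vec3 p q r) = b 0 0 * p + b 0 1 * q + b 0 2%:R * r.
Proof.
rewrite /dot mxE !big_ord_recl big_ord0 !mxE /= addr0 addrA.
by do !congr (_ + _); congr (b _ _ * _); apply/val_inj.
Qed.

(** The map [z |-> z^3] of F_8 = F_2[w] / (w^3 + w + 1), in the basis
    1, w, w^2: the coordinates of the product of [z = p + q w + r w^2] and
    [z^2 = p + r w + (q + r) w^2]. *)
Definition cube (z : 'rV['F_2]_3) : 'rV['F_2]_3 :=
  let p := z 0 0 in let q := z 0 1 in let r := z 0 2%:R in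
  vec3 (p + q + r + q * r) (q + p * q + p * r) (r + p * q).

Lemma vec3K (z : 'rV['F_2]_3) : vec3 (z 0 0) (z 0 1) (z 0 2%:R) = z.
Proof.
by apply/rowP=> -[[|[|[|//]]] lt]; rewrite mxE /=; congr (z _ _); apply/val_inj.
Qed.

Lemma vec3E p q r :
  (vec3 p q r 0 0 = p) * (vec3 p q r 0 1 = q) * (vec3 p q r 0 2%:R = r).
Proof. by rewrite !mxE. Qed.

Lemma cube_vec3 p q r :
  cube (vec3 p q r) = vec3 (p + q + r + q * r) (q + p * q + p * r) (r + p * q).
Proof. by rewrite /cube !vec3E. Qed.

Lemma vec3_inj p q r p' q' r' :
  vec3 p q r = vec3 p' q' r' -> [/\ p = p', q = q' & r = r'].
Proof.
move=> e; split.
- by rewrite -(vec3E p q r).1.1 e vec3E.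
- by rewrite -(vec3E p q r).1.2 e vec3E.
- by rewrite -(vec3E p q r).2 e vec3E.
Qed.

Lemma cube_inj : injective cube.
Proof.
move=> u v; rewrite -(vec3K u) -(vec3K v) !cube_vec3.
move: (u 0 0) (u 0 1) (u 0 2%:R) (v 0 0) (v 0 1) (v 0 2%:R) => p q r p' q' r'.
case/vec3_inj.
by case: (F2_cases p) (F2_cases q) (F2_cases r) => -> [] -> [] ->;
   case: (F2_cases p') (F2_cases q') (F2_cases r') => -> [] -> [] ->.
Qed.

Lemma cube0 : cube 0 = 0.
Proof. by apply/rowP=> k; rewrite !mxE; case: k => [[|[|[|//]]] lt]; apply/val_inj. Qed.

Lemma cube_eq0 z : (cube z == 0) = (z == 0).
Proof. by rewrite -{1}cube0 (inj_eq cube_inj). Qed.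

(** If [b] composed with [cube] is linear, then [b] kills all the polar values
    [cube (u + v) - cube u - cube v], which are the [u v (u + v)] of F_8.  On the
    three pairs of basis vectors these values are linearly independent. *)
Lemma cube_component_nonlinear (a b : 'rV['F_2]_3) :
  (forall z, dot a z = dot b (cube z)) -> b = 0.
Proof.
move=> e.
have polar u v : dot b (cube (u + v) + cube u + cube v) = 0.
  rewrite !dotDr -!e dotDr.
  by case: (F2_cases (dot a u)) (F2_cases (dot a v)) => -> [] ->; apply/val_inj.
have vec3D p q r p' q' r' :
    vec3 p q r + vec3 p' q' r' = vec3 (p + p') (q + q') (r + r').
  by apply/rowP=> -[[|[|[|//]]] lt]; rewrite !mxE.
have e0 := polar (vec3 0 1 0) (vec3 0 0 1).
have e1 := polar (vec3 1 0 0) (vec3 0 0 1).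
have e2 := polar (vec3 1 0 0) (vec3 0 1 0).
move: e0 e1 e2; rewrite !(vec3D, cube_vec3) !dot_vec3 -(vec3K b).
move: (b 0 0) (b 0 1) (b 0 2%:R) => p q r; rewrite !vec3E.
by case: (F2_cases p) (F2_cases q) (F2_cases r) => -> [] -> [] -> // *;
   apply/rowP=> -[[|[|[|//]]] lt]; rewrite !mxE.
Qed.

(** * Switching a plane of the solid *)

Definition twist (v : 'rV['F_2]_(3 + 1)) : 'rV['F_2]_(3 + 1) :=
  row_mx (cube (lsubmx v)) (rsubmx v).

Lemma twist_inj : injective twist.
Proof.
move=> u v /eq_row_mx[/cube_inj el er].
by rewrite -(hsubmxK u) -(hsubmxK v) el er.
Qed.

Lemma twist_eq0 v : (twist v == 0) = (v == 0).
Proof. by rewrite -[in RHS](hsubmxK v) !row_mx_eq0 cube_eq0. Qed.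

Lemma rV1_neq0 (c : 'rV['F_2]_1) : c != 0 -> c = 1%:M.
Proof.
rewrite [c]mx11_scalar; case: (F2_cases (c 0 0)) => -> //.
by rewrite raddf0 eqxx.
Qed.

Section Switching.
Variable x : 'I_15 -> 'rV['F_2]_(3 + 1).
Hypotheses (xI : injective x) (x0 : forall i, x i != 0).

Let y i := twist (x i).
Let yI : injective y. Proof. by move=> i j /twist_inj/xI. Qed.
Let y0 i : y i != 0. Proof. by rewrite twist_eq0. Qed.

Local Notation S := (solid x).
Local Notation F' := (solid_plane x).
Local Notation F := (solid_plane y).
Definition switched := (S :\: F') :|: F.
Local Notation C := switched.

(** The words left after removing the plane are those with last coordinate 1,
    the only nonzero value in F_2. *)
Lemma affineP X :
  reflect (exists a, X = word x (row_mx a 1%:M)) (X \in S :\: F').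
Proof.
rewrite inE; apply: (iffP andP) => [[XF /imsetP[v v0 eX]]|[a ->]].
  exists (lsubmx v); rewrite eX -{1}(hsubmxK v); congr (word x (row_mx _ _)).
  apply: rV1_neq0; apply: contraNneq XF => r0; apply/imsetP.
  exists (lsubmx v); last by rewrite eX -{1}(hsubmxK v) r0.
  by move: v0; rewrite !inE -{1}(hsubmxK v) row_mx_eq0 r0 eqxx andbT.
split; last by rewrite imset_f // !inE row_mx_eq0 oner_eq0 andbF.
apply/imsetP=> -[b _ /(word_inj xI x0)/eq_row_mx[_ /rowP/(_ 0)]].
by rewrite !mxE.
Qed.

(** An equality of words says that the linear forms agree on all labels; reading
    it at the labels [(z, 0)] leaves an identity between a linear form in [z] and
    a component of [cube]. *)
Lemma disjoint_twisted_plane : [disjoint F & S].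
Proof.
rewrite disjoint_subset; apply/subsetP=> _ /imsetP[b b0 ->]; rewrite inE.
apply/imsetP=> -[a _ e]; move: b0; rewrite !inE => /eqP; case.
apply: (@cube_component_nonlinear (lsubmx a)) => z.
have [->|z0] := eqVneq z 0; first by rewrite cube0 !dot0.
have : row_mx z 0 \in x @: setT.
  by rewrite codom_nonzero // !inE row0_eq0.
case/imsetP=> i _ ei; move/setP/(_ i): e; rewrite !inE => /F2_neq0_inj.
rewrite /y /twist -ei row_mxKl row_mxKr -{1}(hsubmxK a) !dot_row !dot0.
by rewrite !addr0.
Qed.

(** The symmetric difference consists of the [(z, t)] with [h z + t <> 0], where
    [h] is a function with [h 0 = 0].  It is thus the graph of [1 + h] over F_2^3,
    which has 8 elements and avoids the zero vector. *)
Lemma affine_twisted_adj a b :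
  symdiff (word x (row_mx a 1%:M)) (word y (row_mx b 0)) \in points.
Proof.
pose h u := dot a u + dot b (cube u).
pose P (v : 'rV['F_2]_(3 + 1)) := h (lsubmx v) + rsubmx v 0 0 != 0.
have -> : symdiff (word x (row_mx a 1%:M)) (word y (row_mx b 0)) =
          [set i | P (x i)].
  apply/setP=> i; rewrite in_symdiff !inE -F2_addb -{1}(hsubmxK (x i)) /P /y /twist /h.
  rewrite !dot_row [dot 0 _]dotC dot0 addr0 addrAC.
  by rewrite [dot 1%:M _]/dot mul1mx mxE.
rewrite mem_points card_preimage //; last first.
  by rewrite /P /h !linear0 cube0 !dot0 mxE !addr0 eqxx.
pose g u : 'rV['F_2]_(3 + 1) := row_mx u (1 + h u)%:M.
have gI : injective g by move=> u v /eq_row_mx[].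
have -> : [set v | P v] = g @: setT.
  apply/setP=> v; rewrite inE /P; apply/idP/imsetP=> [Pv|[u _ ->]].
    exists (lsubmx v); rewrite // -{1}(hsubmxK v); congr row_mx.
    rewrite [LHS]mx11_scalar; congr (_%:M).
    by case: (F2_cases (h (lsubmx v))) (F2_cases (rsubmx v 0 0)) Pv => -> [] -> // _; apply/val_inj.
  rewrite /g row_mxKl row_mxKr !mxE mulr1n.
  by case: (F2_cases (h u)) => ->.
by rewrite card_imset // cardsT card_mx card_Fp.
Qed.

Lemma switched_points : C \subset points.
Proof.
have sub z (zI : injective z) (z0 : forall i, z i != 0) : solid z \subset points.
  by case/andP: (solid_singular zI z0) => /andP[].
rewrite subUset (subset_trans (subsetDl _ _)) ?sub //.
by rewrite (subset_trans (solid_plane_sub _)) ?sub.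
Qed.

Lemma singular_collinear D X Y : singular_subspace D ->
  X \in D -> Y \in D -> X != Y -> collinear X Y.
Proof.
by case/andP=> _ /forall_inP cD XD YD; apply/implyP/(forall_inP (cD X XD)).
Qed.

Lemma clique_switched : clique C.
Proof.
apply/andP; split; first exact: switched_points.
have cross X Y : X \in S :\: F' -> Y \in F -> X != Y ->
    collinear X Y /\ collinear Y X.
  move=> XS YF nXY; have pX : X \in points.
    by apply: (subsetP switched_points); rewrite inE XS.
  have pY : Y \in points.
    by apply: (subsetP switched_points); rewrite inE YF orbT.
  rewrite !collinear_symdiff // 1?eq_sym // (symdiffC Y).
  by case/affineP: XS => a ->; case/imsetP: YF => b _ ->; rewrite affine_twisted_adj.
apply/forall_inP=> X XC; apply/forall_inP=> Y YC; apply/implyP=> nXY.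
rewrite /adjacent nXY; move: XC YC; rewrite ![_ \in C]inE.
case/orP=> [XS|XF] /orP[YS|YF].
- apply: (singular_collinear (solid_singular xI x0)) => //.
  + by case/setDP: XS.
  by case/setDP: YS.
- by case: (cross X Y).
- by case: (cross Y X); rewrite // eq_sym.
exact: (singular_collinear (proj1 (plane_solid_plane yI y0))).
Qed.

Lemma disjoint_affine_twisted : [disjoint S :\: F' & F].
Proof.
rewrite disjoint_sym; apply: disjointWr disjoint_twisted_plane.
exact: subsetDl.
Qed.

Lemma card_switched : #|C| = 15%N.
Proof.
rewrite cardsU (_ : (S :\: F') :&: F = set0) ?cards0 ?subn0; last first.
  by apply/eqP; rewrite setI_eq0 disjoint_affine_twisted.
rewrite cardsD (setIidPr (solid_plane_sub x)) //.
by rewrite card_solid // !card_solid_plane.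
Qed.

Lemma degree_switched i : degree C i = 8%N.
Proof.
rewrite /degree (eq_bigl [predU S :\: F' & F]) => [|B]; last by rewrite in_setU.
rewrite bigU /=; last exact: disjoint_affine_twisted.
have := degree_solid xI x0 i.
rewrite /degree (big_setID F') (setIidPr (solid_plane_sub x)) //=.
have := degree_solid_plane xI x0 i; have := degree_solid_plane yI y0 i.
rewrite /degree /y /twist row_mxKl cube_eq0 => -> ->.
by rewrite addnC.
Qed.

Lemma plane_avoids_switched X : X \in F' -> X \notin C.
Proof.
move=> XF; rewrite !inE XF /=; apply/negP=> XF2.
have /pred0P/(_ X) := disjoint_twisted_plane.
by rewrite /= XF2 (subsetP (solid_plane_sub x)).
Qed.

Lemma not_centered_switched : ~~ centered C.
Proof.
apply/existsP=> -[O /andP[OC /forall_inP cO]].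
(* A center is joined to the other points by lines inside the clique. *)
have third X : X \in C -> X != O -> symdiff O X \in C.
  move=> XC nXO; have pC := subsetP switched_points.
  have aOX : collinear O X.
    have /andP[_ /forall_inP/(_ O OC)/forall_inP/(_ X XC)] := clique_switched.
    by rewrite eq_sym nXO => /andP[].
  have XO : X \in C :\ O by apply/setD1P.
  move: aOX; rewrite collinear_symdiff ?(pC _ OC) ?(pC _ XC) 1?eq_sym // => pOX.
  have lOX := line_in_lines (pC _ OC) (pC _ XC) pOX.
  have /forall_inP/(_ _ lOX)/implyP sub := cO X XO.
  by apply: (subsetP (sub _)); rewrite !in_setU !in_set1 !eqxx !orbT.
have affC a : word x (row_mx a 1%:M) \in C.
  by rewrite inE; apply/orP; left; apply/affineP; exists a.
have affD a b : symdiff (word x (row_mx a 1%:M)) (word x (row_mx b 1%:M)) =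
                word x (row_mx (a + b) 0).
  by rewrite -wordD add_row_mx addvv.
move: (OC); rewrite inE => /orP[/affineP[a eO]|OF].
  (* Any second word with last coordinate 1 will do; the sum of the two indices
     has last coordinate 0 and hence gives a point of the removed plane. *)
  pose b := a + delta_mx 0 0.
  have bD : a + b = delta_mx 0 0 by rewrite addrA addvv add0r.
  have d0 : delta_mx 0 0 != 0 :> 'rV['F_2]_3.
    by apply/eqP=> /rowP/(_ 0); rewrite !mxE eqxx.
  have nba : word x (row_mx b 1%:M) != O.
    rewrite eO (inj_eq (word_inj xI x0)); apply: contraNneq d0 => /eq_row_mx[e _].
    by rewrite -bD e addvv.
  have := third _ (affC b) nba; apply/negP/plane_avoids_switched.
  by rewrite eO affD bD; apply/imsetP; exists (delta_mx 0 0); rewrite // !inE.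
have nOS : O \notin S.
  by have /pred0P/(_ O)/= := disjoint_twisted_plane; rewrite OF /= => ->.
pose B := word x (row_mx 0 1%:M).
have BA : B \in S :\: F' by apply/affineP; exists 0.
have nBO : B != O by apply: contraNneq nOS => <-; case/setDP: BA.
have := third B (affC 0) nBO; rewrite inE => /orP[/affineP[a ea]|/imsetP[c _ ec]].
  have eO : O = word x (row_mx (0 + a) 0).
    by rewrite -affD -ea (symdiffC O) symdiffKl.
  case/imsetP: OF => b b0 eb; apply: (negP nOS); rewrite eO imset_f // !inE.
  by apply: (@word_point_neq0 _ x); rewrite -eO (subsetP switched_points).
case/imsetP: OF => b b0 eb.
have eB : B = word y (row_mx (b + c) 0).
  have -> : row_mx (b + c) 0 = row_mx b 0 + row_mx c 0 :> 'rV_(3 + 1).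
    by rewrite add_row_mx addr0.
  by rewrite wordD -eb -ec symdiffKl.
have /pred0P/(_ B)/= := disjoint_affine_twisted.
rewrite BA /= => /negP; apply; rewrite eB; apply/imsetP; exists (b + c) => //.
rewrite !inE -row0_eq0; apply: (@word_point_neq0 _ y).
by rewrite -eB (subsetP switched_points) ?affC.
Qed.

End Switching.

Lemma nonzero_enumeration :
  exists2 x : 'I_15 -> 'rV['F_2]_(3 + 1), injective x & forall i, x i != 0.
Proof.
have e : 15%N = #|[set~ 0 : 'rV['F_2]_(3 + 1)]| by rewrite cardsC1 card_mx card_Fp.
exists (fun i => enum_val (cast_ord e i)).
  by move=> i j /enum_val_inj/cast_ord_inj.
by move=> i; have := enum_valP (cast_ord e i); rewrite !inE.
Qed.

Local Close Scope ring_scope.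

Theorem theorem2 :
  exists C : {set {set 'I_15}},
    [/\ maximal_clique C, #|C| = 15, ~~ centered C
      & exists S F' F : {set {set 'I_15}},
          [/\ maximal_singular_subspace S,
              plane F' /\ F' \subset S,
              plane F,
              [disjoint F & S]
            & C = (S :\: F') :|: F]].
Proof.
have [x xI x0] := nonzero_enumeration.
pose y i := twist (x i).
have yI : injective y by move=> i j /twist_inj/xI.
have y0 i : (y i != 0)%R by rewrite twist_eq0.
exists (switched x); split.
- apply: maximal_clique_regular; first exact: clique_switched.
    exact: card_switched.
  exact: degree_switched.
- exact: card_switched.
- exact: not_centered_switched.
exists (solid x), (solid_plane x), (solid_plane y); split=> //.
- apply: maximal_singular_regular; first exact: solid_singular.
    exact: card_solid.
  exact: degree_solid.
- by split; [exact: plane_solid_plane | exact: solid_plane_sub].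
- exact: plane_solid_plane.
exact: disjoint_twisted_plane.
Qed.
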